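(* Let $L$ be a finite distributive lattice, and let $I$ be the defining toric ideal of the chain algebra $K[\mathcal{C}_L]$. Then any minimal generator of $I$ has degree at most half the number of maximal chains in $L$.
   Context: Let $L$ be a finite distributive lattice with elements labelled as variables $t_1,\ldots,t_s$ over a field $K$. To a maximal chain $C$ of $L$ associate the monomial $t_C=\prod_{t_i\in C}t_i$. The chain algebra $K[\mathcal{C}_L]$ is the $K$-subalgebra of $K[t_1,\ldots,t_s]$ generated by all $t_C$, $C$ a maximal chain of $L$. Its defining toric ideal is the kernel $I$ of the surjective $K$-algebra homomorphism $K[T_C\mid C \text{ a maximal chain of }L]\to K[\mathcal{C}_L]$, $T_C\mapsto t_C$; it is homogeneous with respect to the standard grading $\deg T_C=1$. A minimal generator of $I$ means an element of a minimal homogeneous generating set of $I$. *)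

(* Defs.v *)
From mathcomp Require Import all_boot all_order all_algebra.
From mathcomp Require Import mpoly.

Set Implicit Arguments.
Unset Strict Implicit.
Unset Printing Implicit Defensive.

Import Order.TTheory GRing.Theory.
Local Open Scope ring_scope.

Section MaximalChains.
Variables (d : Order.disp_t) (L : finTBDistrLatticeType d).

Definition is_chain : pred {set L} :=
  [pred C : {set L} | [forall x in C, forall y in C, (x >=< y)%O]].

Definition max_chains : {set {set L}} := [set C | maxset is_chain C].

End MaximalChains.

Section ChainAlgebra.
Variables (K : fieldType) (d : Order.disp_t) (L : finTBDistrLatticeType d).

(* The variables t_1, ..., t_s and T_C are numbered by the enumerations of L
   and of its set of maximal chains. *)
Definition lat_ring := {mpoly K[#|L|]}.
Definition chain_ring := {mpoly K[#|max_chains L|]}.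

Definition lat_var (x : L) : lat_ring := 'X_(enum_rank x).

Definition chain_monomial (C : {set L}) : lat_ring := \prod_(x in C) lat_var x.

Inductive chain_algebra : lat_ring -> Prop :=
| chain_algebra_const (c : K) : chain_algebra c%:MP
| chain_algebra_gen C : C \in max_chains L -> chain_algebra (chain_monomial C)
| chain_algebra_add p q :
    chain_algebra p -> chain_algebra q -> chain_algebra (p + q)
| chain_algebra_mul p q :
    chain_algebra p -> chain_algebra q -> chain_algebra (p * q).

Definition toric_map : chain_ring -> lat_ring :=
  mmap (@mpolyC #|L| K) (fun i => chain_monomial (enum_val i)).

(* The map to K[C_L] is toric_map with codomain restricted to its image, hence
   has the kernel of toric_map. *)
Lemma toric_map_image q : chain_algebra q <-> exists p, toric_map p = q.
Proof.
split.
- elim=> [c|C CL|p1 p2 _ [q1 <-] _ [q2 <-]|p1 p2 _ [q1 <-] _ [q2 <-]].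
  + by exists c%:MP; rewrite /toric_map mmapC.
  + exists 'X_(enum_rank_in CL C).
    by rewrite /toric_map mmapX mmap1U enum_rankK_in.
  + by exists (q1 + q2); rewrite /toric_map raddfD.
  + by exists (q1 * q2); rewrite /toric_map rmorphM.
- case=> p <-; elim/mpolyind: p => [|c m p _ _ IHp].
    by rewrite /toric_map raddf0 -mpolyC0; constructor.
  rewrite /toric_map raddfD /=; apply: chain_algebra_add => //.
  rewrite mmapZ mmapX; apply: chain_algebra_mul; first by constructor.
  rewrite /mmap1; elim/big_ind: _ => [|x y|i _].
  + by rewrite -mpolyC1; constructor.
  + exact: chain_algebra_mul.
  + elim: (m i) => [|k IHk]; first by rewrite expr0 -mpolyC1; constructor.
    rewrite exprS; apply: chain_algebra_mul => //.
    by apply: chain_algebra_gen; exact: enum_valP.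
Qed.

Definition toric_ideal (p : chain_ring) : Prop := toric_map p = 0.

End ChainAlgebra.

Section Generators.
Variables (n : nat) (K : fieldType).
Implicit Types (G H I : {mpoly K[n]} -> Prop).

Definition gen_ideal G (p : {mpoly K[n]}) : Prop :=
  exists2 s : seq ({mpoly K[n]} * {mpoly K[n]}),
    (forall ag, ag \in s -> G ag.2) & p = \sum_(ag <- s) ag.1 * ag.2.

Definition homog_generating I G : Prop :=
  (forall g, G g -> exists k, g \is k.-homog) /\
  (forall p, I p <-> gen_ideal G p).

(* Minimality is with respect to inclusion. *)
Definition min_homog_generating I G : Prop :=
  homog_generating I G /\
  (forall H, homog_generating I H -> (forall g, H g -> G g) ->
     forall g, G g -> H g).

Definition min_generator I (g : {mpoly K[n]}) : Prop :=
  exists2 G, min_homog_generating I G & G g.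

End Generators.

(* Main.v *)
Require Import Defs.
From mathcomp Require Import all_boot all_order all_algebra.
From mathcomp Require Import mpoly.

(** The toric ideal is spanned in each degree by the binomials u - v, where u
    and v are multisets of maximal chains of the same size r covering every
    element of L equally often; call the set of all multisets equivalent to u
    in this sense the fibre of u.  Two members of a fibre that share a chain
    differ by a multiple of a binomial of smaller degree.  So a generator of
    degree r is superfluous unless some fibre of degree r is disconnected, when
    multisets with a common chain are joined together with those related by
    smaller binomials.

    The key point is that a fibre containing a multiset u with a repeated chain
    is connected.  Let v lie in that fibre, let D be a chain of v, and let s be
    the set of distinct chains of u, k of them.  Then the covering numbers of s
    minus those of D are again those of k - 1 maximal chains.  By the weighted
    form of Dilworth's theorem this only needs that s minus D has weight at
    most k - 1 on each antichain A.  This is clear if D meets A.  If D misses A,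
    then v has weight less than r on A, hence so has u, so some chain of u, and
    therefore of s, misses A as well (lemma chain_mult_exchange).  Hence s can
    be traded, by a relation of degree k < r, for a multiset containing D, and u
    becomes a multiset sharing D with v.  The k - 1 chains that Dilworth's theorem
    provides are maximal because all maximal chains of L have the same size
    (lemma chain_le_max_chain).

    Consequently, a disconnected fibre of degree r contains two disjoint
    multisets without repetitions, which together use 2r distinct maximal
    chains.  If 2r exceeds the number of maximal chains, then every relation of
    degree r is generated by relations of smaller degree, and cannot belong to
    a minimal homogeneous generating set. *)

Set Implicit Arguments.
Unset Strict Implicit.
Unset Printing Implicit Defensive.
Import Order.TTheory GRing.Theory.

(** * Weighted Dilworth theorem *)

Section Dilworth.
Variables (d : Order.disp_t) (T : finPOrderType d).
Implicit Types (A B C : {set T}) (E : seq {set T}) (f : T -> nat).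

(** On a finite distributive lattice this is is_chain. *)
Definition chain : pred {set T} :=
  [pred C : {set T} | [forall x in C, forall y in C, (x >=< y)%O]].

(** Boolean, so that the proof of Dilworth's theorem can decide whether all
    antichains satisfy a weight bound. *)
Definition antichain : pred {set T} :=
  [pred A : {set T} | [forall x in A, forall y in A, (x <= y)%O ==> (x == y)]].

Definition weight f A := \sum_(x in A) f x.

Lemma chainP C :
  reflect {in C &, forall x y, (x >=< y)%O} (C \in chain).
Proof.
rewrite inE; apply: (iffP forall_inP) => [h x y xC yC|h x xC].
  by move/forall_inP: (h x xC) => /(_ y yC).
by apply/forall_inP => y yC; exact: h.
Qed.

Lemma antichainP A :
  reflect {in A &, forall x y, (x <= y)%O -> x = y} (A \in antichain).
Proof.
rewrite inE; apply: (iffP forall_inP) => [h x y xA yA xy|h x xA].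
  by move/forall_inP: (h x xA) => /(_ y yA); rewrite xy => /eqP.
by apply/forall_inP => y yA; apply/implyP => xy; apply/eqP/h.
Qed.

Lemma sum_mem_card A C : \sum_(x in A) (x \in C) = #|A :&: C|.
Proof.
rewrite -sum1_card big_mkcond [RHS]big_mkcond /=.
by apply: eq_bigr => x _; rewrite inE; do 2!case: (_ \in _).
Qed.

Lemma sum_mem_eq A a : \sum_(x in A) (x == a) = (a \in A).
Proof.
under eq_bigr => x _ do rewrite -in_set1.
rewrite sum_mem_card -[a \in A]lt0b; case: (boolP (a \in A)) => aA.
  by rewrite (setIidPr _) ?cards1 // sub1set.
by apply/eqP; rewrite cards_eq0 setIC setI_eq0 disjoints1 aA.
Qed.

Lemma antichain_meet_chain A C :
  A \in antichain -> C \in chain -> #|A :&: C| <= 1.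
Proof.
move=> /antichainP hA /chainP hC; apply/card_le1_eqP => x y.
rewrite !inE => /andP[xA xC] /andP[yA yC].
by case/orP: (hC x y xC yC) => /hA h; [symmetry|]; apply: h.
Qed.

Lemma ex_maximal (P : pred T) x0 :
  P x0 -> exists2 x, P x & forall y, P y -> (x <= y)%O -> y = x.
Proof.
move=> Px0; pose above (x : T) := #|[set y : T | (x <= y)%O]|.
case: (arg_minnP above Px0) => x Px xmin; exists x => // y Py xy.
apply/eqP; have := xmin y Py; apply: contraTT => nyx; rewrite -ltnNge.
apply: proper_card; apply/properP; split.
  by apply/subsetP=> z; rewrite !inE => /(le_trans xy).
exists x; rewrite !inE ?lexx //.
by apply: contraNN nyx => yx; rewrite eq_le xy yx.
Qed.

Lemma weight_chains f E A :
    (forall x, f x = \sum_(C <- E) (x \in C)) ->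
  weight f A = \sum_(C <- E) #|A :&: C|.
Proof.
move=> fE; rewrite /weight; under eq_bigr => x _ do rewrite fE.
by rewrite exchange_big /=; apply: eq_bigr => C _; rewrite sum_mem_card.
Qed.

(** Each chain contributes at most one to the weight of an antichain, so an
    antichain of the largest conceivable weight cannot miss any of them. *)
Lemma tight_meets_chains E A :
    A \in antichain -> {in E, forall C, C \in chain} ->
    size E <= \sum_(C <- E) #|A :&: C| ->
  {in E, forall C, exists2 x, x \in A & x \in C}.
Proof.
move=> hA hE hs C CE; apply/exists_inP; apply: contraLR hs.
rewrite -ltnNge => /exists_inPn nC.
have C0 : #|A :&: C| = 0.
  apply/eqP; rewrite cards_eq0; apply/eqP/setP=> x; rewrite !inE.
  by apply/negP=> /andP[/nC/negP].
rewrite (perm_big _ (perm_to_rem CE)) big_cons /= C0 add0n.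
rewrite -[size E](prednK _) -?(size_rem CE); last by case: (E) CE.
rewrite ltnS -sum1_size [X in X <= _]big_seq [X in _ <= X]big_seq.
apply: leq_sum => B.
by move/mem_rem/hE; exact: antichain_meet_chain.
Qed.

(** Galvin's proof of Dilworth's theorem, with f x in the role of the number of
    copies of x.  One copy of a maximal element a of the support is removed and
    the rest is split into chains by induction.  Suppose that some
    antichain still has weight k, and call such antichains tight.  Each of the
    chains meets every tight antichain, and the topmost points where the chains
    meet tight antichains form a tight antichain again.  The element a lies
    above one of these points, and a together with the part of that chain up to
    the point meets every tight antichain, so it can be split off. *)
Lemma weighted_Dilworth f k :
    {in antichain, forall A, weight f A <= k} ->
  exists E, [/\ size E = k, {in E, forall C, C \in chain}
               & forall x, f x = \sum_(C <- E) (x \in C)].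
Proof.
have [n] := ubnP (\sum_x f x); elim: n f k => // n IHn f k sumf fk.
have [f0|[a0 fa0]] : (forall x, f x = 0) \/ exists x, f x > 0.
  case: (pickP (fun x => f x > 0)) => [x fx|f0]; first by right; exists x.
  by left=> x; apply/eqP; rewrite -leqn0 leqNgt f0.
  exists (nseq k set0); rewrite size_nseq; split=> // [C /nseqP[-> _]|x].
    by apply/chainP => x y; rewrite inE.
  by rewrite f0 big1_seq // => C /nseqP[-> _]; rewrite inE.
(* a is maximal in the support of f, and f' is f with one copy of a removed *)
have [a fa amax] := @ex_maximal (fun x => 0 < f x) a0 fa0.
pose f' x := f x - (x == a).
have f'E x : f x = f' x + (x == a).
  by rewrite /f'; case: eqP => [->|_]; rewrite ?subn0 ?addn0 // subnK.
have wE A : weight f A = weight f' A + (a \in A).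
  rewrite /weight; under eq_bigr => x _ do rewrite f'E.
  by rewrite big_split /= sum_mem_eq.
have sumE g : \sum_x g x = weight g [set: T].
  by apply: eq_bigl => x; rewrite inE.
have sumf' : \sum_x f' x < n.
  by move: sumf; rewrite !sumE wE inE addn1.
have k_gt0 : 0 < k.
  apply: leq_trans (fk [set a] _); first by rewrite /weight big_set1.
  by apply/antichainP=> x y; rewrite !inE => /eqP-> /eqP->.
(* if the bound drops with a, then a is a chain of its own *)
case: (boolP [forall A : {set T}, (A \in antichain) ==> (weight f' A <= k.-1)]).
  move=> /forallP hk.
  case: (IHn f' k.-1 sumf') => [A hA|E [sE cE fE]]; first exact: (implyP (hk A)).
  exists ([set a] :: E); split=> /=; first by rewrite sE prednK.
    move=> C; rewrite inE => /predU1P[->|/cE//].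
    by apply/chainP=> x y; rewrite !inE => /eqP-> /eqP->; exact: comparablexx.
  by move=> x; rewrite big_cons in_set1 -fE f'E addnC.
move=> /forallPn[A0]; rewrite negb_imply -ltnNge => /andP[aA0 wA0].
case: (IHn f' k sumf') => [A hA|E [sE cE fE]].
  by apply: leq_trans (fk A hA); rewrite wE leq_addr.
pose tight B := (B \in antichain) && (k <= weight f' B).
have tightP B C : tight B -> C \in E -> exists2 x, x \in B & x \in C.
  case/andP=> hB wB; apply: tight_meets_chains hB cE _ C.
  by rewrite sE -(weight_chains _ fE).
pose istight x := [exists B : {set T}, tight B && (x \in B)].
pose top C x := [&& x \in C, istight x &
                  [forall (y | (y \in C) && istight y), (y <= x)%O]].
have topP C x y : top C x -> y \in C -> istight y -> (y <= x)%O.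
  by case/and3P=> _ _ /forall_inP h yC ty; apply: h; rewrite yC.
have ex_top C : C \in E -> exists x, top C x.
  move=> CE; have tA0 : tight A0 by rewrite /tight aA0 -(prednK k_gt0).
  have [x xA0 xC] := tightP _ _ tA0 CE.
  have tx : (x \in C) && istight x.
    by rewrite xC; apply/existsP; exists A0; rewrite tA0.
  case: (@ex_maximal (fun y => (y \in C) && istight y) x tx) => z.
  case/andP=> zC tz zmax; exists z.
  rewrite /top zC tz; apply/forall_inP=> y yP.
  have /andP[yC _] := yP; case/orP: (chainP _ (cE C CE) y z yC zC) => //.
  by move/(zmax y yP) ->.
(* the tops of the chains form an antichain: if x <= y, the tight antichain
   through y meets the chain of x at or below x, hence in y *)
pose A := [set x | has (fun C => top C x) E].
have aA : A \in antichain.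
  apply/antichainP=> x y; rewrite !inE => /hasP[C CE tCx] /hasP[C' _ tCy] xy.
  have /and3P[_ /existsP[B /andP[tB yB]] _] := tCy.
  have [z zB zC] := tightP _ _ tB CE.
  have zx : (z <= x)%O.
    by apply: topP tCx zC _; apply/existsP; exists B; rewrite tB.
  have zy : z = y.
    by apply: (antichainP _ (proj1 (andP tB))) => //; exact: le_trans xy.
  by apply/eqP; rewrite eq_le xy -zy.
have wA : k <= weight f' A.
  rewrite (weight_chains _ fE) -sE -sum1_size [X in X <= _]big_seq [X in _ <= X]big_seq.
  apply: leq_sum => C CE; have [x tx] := ex_top C CE.
  apply/card_gt0P; exists x; have /and3P[xC _ _] := tx.
  by rewrite !inE xC andbT; apply/hasP; exists C.
have naA : a \notin A.
  by apply: contraL (fk A aA) => a_A; rewrite -ltnNge wE a_A /= addn1 ltnS wA.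
(* otherwise a could be added to A, which would then be too heavy *)
have [x xA xa] : exists2 x, x \in A & (x >=< a)%O.
  apply/exists_inP; apply: contraT => /exists_inPn hinc.
  have : a |: A \in antichain.
    apply/antichainP=> x y; rewrite !in_setU1 => /predU1P[->|xA] /predU1P[->|yA] //.
    - by move=> ay; move: (hinc y yA); rewrite /Order.comparable ay orbT.
    - by move=> xa; move: (hinc x xA); rewrite /Order.comparable xa.
    - exact: (antichainP _ aA).
  move/fk; rewrite /weight (big_setU1 _ naA) /= -/(weight f A) leqNgt => /negP[].
  by rewrite -add1n leq_add // wE (leq_trans wA) // leq_addr.
have [C CE tx] : exists2 C, C \in E & top C x by move: xA; rewrite inE => /hasP.
have /and3P[xC _ _] := tx.
have f'gt y : y \in C -> 0 < f' y.
  by move=> yC; rewrite fE (perm_big _ (perm_to_rem CE)) big_cons yC.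
have {}xa : (x < a)%O.
  rewrite lt_neqAle; apply/andP; split; first by apply: contraNneq naA => <-.
  case/orP: xa => // ax; rewrite -(amax x) //.
  by rewrite f'E ltn_addr // f'gt.
pose K := [set z in C | (z <= x)%O].
pose f'' y := f' y - (y \in K).
have f''E y : f' y = f'' y + (y \in K).
  rewrite /f''; case: (boolP (y \in K)) => [yK|_]; rewrite ?addn0 ?subn0 //.
  by rewrite subnK // f'gt //; move: yK; rewrite inE => /andP[].
have w''E B : weight f' B = weight f'' B + #|B :&: K|.
  rewrite -sum_mem_card /weight -big_split /=.
  by apply: eq_bigr => y _; rewrite -f''E.
case: (IHn f'' k.-1) => [|B aB|E' [sE' cE' fE']].
- by apply: leq_ltn_trans sumf'; rewrite !sumE w''E leq_addr.
- have [wB|wB] := ltnP (weight f' B) k.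
    by rewrite -ltnS prednK //; apply: leq_ltn_trans wB; rewrite w''E leq_addr.
  have tB : tight B by apply/andP.
  have [y yB yC] := tightP _ _ tB CE.
  have yx : (y <= x)%O by apply: topP tx yC _; apply/existsP; exists B; rewrite tB.
  have BK : 0 < #|B :&: K| by apply/card_gt0P; exists y; rewrite !inE yB yC.
  rewrite -ltnS prednK //; apply: leq_trans (fk B aB).
  by rewrite wE w''E -addnA -[X in X < _]addn0 ltn_add2l ltn_addr.
exists (a |: K :: E'); split=> /=; first by rewrite sE' prednK.
  move=> B; rewrite inE => /predU1P[->|/cE'//].
  have Ka z : z \in K -> (z <= a)%O.
    by rewrite inE => /andP[_ zx]; apply/ltW/(le_lt_trans zx).
  apply/chainP=> y z; rewrite [y \in _]inE [z \in _]inE !in_set1.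
  case/orP=> [/eqP->|yK] /orP[/eqP->|zK]; first exact: comparablexx.
  - by rewrite /Order.comparable (Ka z) // orbT.
  - by rewrite /Order.comparable (Ka y).
  - by apply: (chainP _ (cE C CE)); [move: yK|move: zK]; rewrite inE => /andP[].
have aK : a \in K = false by rewrite inE (lt_geF xa) andbF.
move=> y; rewrite big_cons -fE' f'E f''E in_setU1.
by case: eqP => [->|_] /=; rewrite ?aK /= ?addn0 addnC.
Qed.
End Dilworth.

Lemma ex_minimal (d : Order.disp_t) (T : finPOrderType d) (P : pred T) x0 :
  P x0 -> exists2 x, P x & forall y, P y -> (y <= x)%O -> y = x.
Proof. exact: (@ex_maximal _ T^d). Qed.

(** * Maximal chains of a distributive lattice have the same size *)

Section MaxChains.
Variables (d : Order.disp_t) (L : finTBDistrLatticeType d).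
Implicit Types (C D : {set L}).

Lemma max_chain_chain D : D \in max_chains L -> D \in @chain _ L.
Proof. by rewrite inE => /maxsetp. Qed.

Lemma max_chain_absorb D y :
  D \in max_chains L -> {in D, forall x, (x >=< y)%O} -> y \in D.
Proof.
move=> mD yD; have /chainP cD := max_chain_chain mD.
move: mD; rewrite inE => /maxsetP[_ /(_ (y |: D))] <-.
- by rewrite setU11.
- apply/chainP => u v; rewrite !in_setU1.
  case/predU1P=> [->|uD] /predU1P[->|vD].
  + exact: comparablexx.
  + by rewrite comparable_sym yD.
  + exact: yD.
  + exact: cD.
- exact: subsetUr.
Qed.

(** Distributivity makes the size of a maximal chain D an upper bound for all
    chains: attach to x the set of all e in D, other than the bottom, whose meet
    with x does not lie below the predecessor of e in D.  This set grows
    strictly with x, and has fewer than #|D| elements. *)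
Lemma chain_le_max_chain C D :
  C \in @chain _ L -> D \in max_chains L -> #|C| <= #|D|.
Proof.
move=> /chainP cC mD; have /chainP cD := max_chain_chain mD.
have botD : \bot%O \in D.
  by apply: max_chain_absorb mD _ => x _; rewrite /Order.comparable le0x orbT.
have topD : \top%O \in D.
  by apply: max_chain_absorb mD _ => x _; rewrite /Order.comparable lex1.
pose jump x := [set e in D | (e != \bot%O) &&
  [forall e' in D, (e' < e)%O ==> ~~ (e `&` x <= e')%O]].
have jumpP x e : reflect [/\ e \in D, e != \bot%O
    & forall e', e' \in D -> (e' < e)%O -> ~~ (e `&` x <= e')%O] (e \in jump x).
  rewrite inE; apply: (iffP and3P) => -[eD e0 h]; split=> //.
    by move=> e' e'D; move/forall_inP: h => /(_ e' e'D)/implyP.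
  by apply/forall_inP=> e' e'D; apply/implyP; exact: h.
have jumpD x : #|jump x| < #|D|.
  apply: proper_card; apply/properP; split.
    by apply/subsetP=> e /jumpP[].
  by exists \bot%O => //; rewrite inE eqxx andbF.
have jump_lt x y : (x < y)%O -> #|jump x| < #|jump y|.
  move=> xy; apply: proper_card; apply/properP; split.
    apply/subsetP=> e /jumpP[eD e0 h]; apply/jumpP; split=> // e' e'D /h-/(_ e'D).
    by apply: contraNN; apply: le_trans; apply: leI2 => //; exact: ltW.
  (* the lowest step of D at which x and y are told apart *)
  have [|e] := @ex_minimal _ L (fun z => (z \in D) && ~~ (z `&` y <= x)%O) \top%O.
    by rewrite topD meet1x (lt_geF xy).
  case/andP=> eD eyx emin.
  have below_e e' : e' \in D -> (e' < e)%O -> (e' `&` y <= x)%O.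
    move=> e'D e'e; apply: contraTT (e'e) => e'yx.
    by have := emin e'; rewrite e'D e'yx (ltW e'e) => ->; rewrite ?ltxx.
  have e_neq0 : e != \bot%O by apply: contraNneq eyx => ->; rewrite meet0x le0x.
  exists e.
    apply/jumpP; split=> // e' e'D e'e; apply: contraNN eyx => eye'.
    apply: le_trans (below_e _ e'D e'e).
    by rewrite lexI eye' leIr.
  apply/negP=> /jumpP[_ _ h].
  have [|p] := @ex_maximal _ L (fun z => (z \in D) && (z < e)%O) \bot%O.
    by rewrite botD lt0x.
  case/andP=> pD pe pmax.
  (* z lies between p and its successor e in D, so maximality leaves z = e *)
  pose z := (p `|` (e `&` x))%O.
  have ze : (z <= e)%O by rewrite leUx (ltW pe) leIl.
  have pz : (p <= z)%O by rewrite leUl.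
  have zD : z \in D.
    apply: max_chain_absorb mD _ => w wD.
    case/orP: (cD w e wD eD) => [we|ew]; last first.
      by rewrite /Order.comparable (le_trans ze ew) orbT.
    have [->|nwe] := eqVneq w e; first by rewrite /Order.comparable ze orbT.
    have {nwe}we : (w < e)%O by rewrite lt_neqAle nwe.
    rewrite /Order.comparable; case/orP: (cD w p wD pD) => [wp|pw].
      by rewrite (le_trans wp pz).
    by rewrite (pmax w) ?pz // wD.
  have ez : z = e.
    apply: contraNeq (h p pD pe) => nze.
    by rewrite -(pmax z) ?leUr // zD lt_neqAle nze.
  case/negP: eyx; rewrite -ez meetUl leUx (below_e p pD pe).
  by rewrite (le_trans (leIl _ _)) // leIr.
have D0 : 0 < #|D| by apply/card_gt0P; exists \bot%O.
pose rank x : 'I_(#|D|.-1.+1) := inord #|jump x|.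
have rankE x : rank x = #|jump x| :> nat by rewrite inordK ?prednK.
rewrite -[#|D|]prednK // -[X in _ <= X]card_ord.
rewrite -(@card_in_imset _ _ rank) ?max_card // => x y xC yC /(congr1 val).
rewrite /= !rankE => jxy; apply/eqP; apply: contraT => nxy.
case/orP: (cC x y xC yC) => lexy.
  have /jump_lt : (x < y)%O by rewrite lt_neqAle nxy.
  by rewrite jxy ltnn.
have /jump_lt : (y < x)%O by rewrite lt_neqAle eq_sym nxy.
by rewrite jxy ltnn.
Qed.

Lemma max_chain_card C D :
  C \in max_chains L -> D \in max_chains L -> #|C| = #|D|.
Proof.
move=> mC mD; apply/eqP; rewrite eqn_leq.
by rewrite !chain_le_max_chain // max_chain_chain.
Qed.

Lemma max_chain_of_card C D :
  C \in @chain _ L -> D \in max_chains L -> #|C| = #|D| -> C \in max_chains L.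
Proof.
move=> cC mD CD; rewrite inE; apply/maxsetP; split=> [//|B cB CB].
by apply/esym/eqP; rewrite eqEcard CB CD chain_le_max_chain.
Qed.

End MaxChains.

(** * Multisets of maximal chains *)

Section Fibres.
Variables (d : Order.disp_t) (L : finTBDistrLatticeType d).
Local Notation n := #|max_chains L|.
Local Notation mchain i := (@enum_val _ (mem (max_chains L)) i).
Implicit Types (m q : 'X_{1..n}).

Definition chain_mult m x := \sum_(i < n) m i * (x \in mchain i).

(** The set of distinct chains of the multiset m, that is, the radical of the
    monomial with exponent m. *)
Definition mrad m : 'X_{1..n} := [multinom (0 < m i : nat) | i < n].

Lemma mchainP i : mchain i \in max_chains L.
Proof. exact: enum_valP. Qed.

Lemma weight_chain_mult m A :
  weight (chain_mult m) A = \sum_(i < n) m i * #|A :&: mchain i|.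
Proof.
rewrite /weight exchange_big; apply: eq_bigr => i _ /=.
by rewrite -big_distrr /= sum_mem_card.
Qed.

Lemma chain_multD m q x : chain_mult (m + q)%MM x = chain_mult m x + chain_mult q x.
Proof.
by rewrite -big_split; apply: eq_bigr => i _; rewrite mnmDE mulnDl.
Qed.

Lemma chain_mult0 x : chain_mult 0%MM x = 0.
Proof. by apply: big1 => i _; rewrite mnm0E. Qed.

Lemma chain_multU i x : chain_mult U_(i)%MM x = (x \in mchain i).
Proof.
rewrite /chain_mult (bigD1 i) //= mnm1E eqxx mul1n big1 ?addn0 // => j ji.
by rewrite mnm1E eq_sym (negbTE ji).
Qed.

Lemma mrad_le m : (mrad m <= m)%MM.
Proof. by apply/mnm_lepP=> i; rewrite mnmE; case: (m i). Qed.

(** The chains of Dilworth's theorem have at most #|D| elements each; the total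
    weight forces equality, so that they are maximal. *)
Lemma max_chains_of_antichain_bound (g : L -> nat) k (D : {set L}) :
    D \in max_chains L ->
    {in @antichain _ L, forall A, weight g A <= k} ->
    \sum_x g x = k * #|D| ->
  exists2 q, mdeg q = k & chain_mult q =1 g.
Proof.
move=> mD gk sg; have [E [sE cE gE]] := weighted_Dilworth gk.
have mE C : C \in E -> C \in max_chains L.
  move=> CE; apply: (max_chain_of_card (cE C CE) mD); apply/eqP.
  rewrite eqn_leq (chain_le_max_chain (cE C CE) mD) /=; apply: contraT.
  rewrite -ltnNge => CD.
  have : \sum_x g x < k * #|D|.
    under eq_bigr => x _ do rewrite gE.
    rewrite exchange_big /= (perm_big _ (perm_to_rem CE)) big_cons /=.
    have cardE (B : {set L}) : \sum_x (x \in B) = #|B|.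
      by rewrite -sum1_card [RHS]big_mkcond; apply: eq_bigr => x _; case: (x \in B).
    rewrite cardE -sE (perm_size (perm_to_rem CE)) mulSn -addSn leq_add // -/(size _).
    rewrite -sum1_size big_distrl /= [X in X <= _]big_seq [X in _ <= X]big_seq.
    apply: leq_sum => B /mem_rem BE.
    by rewrite cardE mul1n (chain_le_max_chain (cE B BE) mD).
  by rewrite sg ltnn.
exists (\sum_(C <- E) U_(enum_rank_in mD C))%MM.
  by rewrite mdeg_sum -sE -sum1_size; apply: eq_bigr => C _; rewrite mdeg1.
move=> x; rewrite gE.
rewrite (big_morph (chain_mult^~ x) (fun m q => chain_multD m q x) (chain_mult0 x)).
rewrite big_seq [RHS]big_seq; apply: eq_bigr => C CE.
by rewrite chain_multU enum_rankK_in ?mE.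
Qed.

(** If the chain D of m' misses an antichain A, then m' has weight less than its
    degree on A, and so has m; hence a chain of m misses A too.  Therefore
    removing D from the covering numbers of mrad m lowers the largest weight of
    an antichain, and Dilworth's theorem recovers a multiset containing D. *)
Lemma chain_mult_exchange m m' i :
    chain_mult m =1 chain_mult m' -> mdeg m = mdeg m' -> 0 < m' i ->
  exists q, [/\ 0 < q i, mdeg q = mdeg (mrad m)
               & chain_mult q =1 chain_mult (mrad m)].
Proof.
move=> mm' dmm' m'i; set D := mchain i.
have wD A (t : 'X_{1..n}) : A \in @antichain _ L -> weight (chain_mult t) A <= mdeg t.
  move=> aA; rewrite weight_chain_mult mdegE; apply: leq_sum => j _.
  rewrite -[X in _ <= X]muln1 leq_mul2l antichain_meet_chain ?orbT //.
  exact: max_chain_chain (mchainP j).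
have wlt A (t : 'X_{1..n}) j : A \in @antichain _ L -> 0 < t j ->
    A :&: mchain j = set0 -> weight (chain_mult t) A < mdeg t.
  move=> aA tj Aj; rewrite weight_chain_mult mdegE (bigD1 j) //= [X in _ < X](bigD1 j) //=.
  rewrite Aj cards0 muln0 add0n -add1n leq_add //; apply: leq_sum => l _.
  rewrite -[X in _ <= X]muln1 leq_mul2l antichain_meet_chain ?orbT //.
  exact: max_chain_chain (mchainP l).
have Dchain_mult x : x \in D -> 0 < chain_mult (mrad m) x.
  move=> xD; have : 0 < chain_mult m x.
    by rewrite mm' /chain_mult (bigD1 i) //= xD muln1 ltn_addr.
  rewrite !lt0n; apply: contraNN; rewrite !sum_nat_eq0 => /forall_inP h.
  apply/forall_inP=> j _; move: (h j isT); rewrite mnmE !muln_eq0.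
  by case: (m j).
pose g x := chain_mult (mrad m) x - (x \in D).
have gE x : chain_mult (mrad m) x = g x + (x \in D).
  rewrite /g; case: (boolP (x \in D)) => [/Dchain_mult h|_]; rewrite ?addn0 ?subn0 //.
  by rewrite subnK.
have wg A : weight (chain_mult (mrad m)) A = weight g A + #|A :&: D|.
  by rewrite -sum_mem_card /weight -big_split /=; apply: eq_bigr => x _; rewrite -gE.
have [j mj] : exists j, 0 < m j.
  apply/existsP; apply: contraLR m'i => /existsPn h; rewrite -leqNgt leqn0.
  have : mdeg m = 0.
    by rewrite mdegE big1 // => j _; apply/eqP; rewrite -leqn0 leqNgt.
  by rewrite dmm' => /eqP; rewrite mdeg_eq0 => /eqP ->; rewrite mnm0E.
have rad_gt0 : 0 < mdeg (mrad m).
  by rewrite mdegE (bigD1 j) //= mnmE mj.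
have [||q dq qg] := @max_chains_of_antichain_bound g (mdeg (mrad m)).-1 D (mchainP i).
- move=> A aA; rewrite -ltnS prednK //.
  have [AD|] := posnP #|A :&: D|; last first.
    move=> AD; apply: leq_trans (wD A (mrad m) aA).
    by rewrite wg -addn1 leq_add2l.
  have AD0 : A :&: D = set0 by apply/eqP; rewrite -cards_eq0 AD.
  have wm : weight (chain_mult m) A < mdeg m.
    have -> : weight (chain_mult m) A = weight (chain_mult m') A by apply: eq_bigr.
    by rewrite dmm' (wlt A m' i).
  have [l ml Al] : exists2 l, 0 < m l & A :&: mchain l = set0.
    suff /exists_inP[l ml /eqP] : [exists (l | 0 < m l), A :&: mchain l == set0].
      by exists l.
    apply: contraLR wm => /exists_inPn h; rewrite -leqNgt weight_chain_mult mdegE.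
    apply: leq_sum => l _; have [->//|ml] := posnP (m l).
    by rewrite -[X in X <= _]muln1 leq_mul2l card_gt0 h ?orbT.
  have := wlt A (mrad m) l aA; rewrite mnmE ml => /(_ isT Al).
  by rewrite wg AD addn0.
- have sumT (h : L -> nat) : \sum_x h x = weight h [set: L].
    by apply: eq_bigl => x; rewrite inE.
  have : weight (chain_mult (mrad m)) [set: L] = mdeg (mrad m) * #|D|.
    rewrite weight_chain_mult mdegE big_distrl; apply: eq_bigr => l _ /=.
    by rewrite setTI (max_chain_card (mchainP l) (mchainP i)).
  rewrite sumT wg setTI -{1}(prednK rad_gt0) mulSn addnC => /eqP.
  by rewrite eqn_add2l => /eqP.
exists (U_(i) + q)%MM; split.
- by rewrite mnmDE mnm1E eqxx.
- by rewrite mdegD mdeg1 dq add1n prednK.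
- by move=> x; rewrite chain_multD chain_multU qg gE addnC.
Qed.
End Fibres.

(** * Ideals generated by homogeneous polynomials *)

Section GenIdeal.
Variables (n : nat) (K : fieldType).
Local Open Scope ring_scope.
Implicit Types (G H I : {mpoly K[n]} -> Prop) (p q g : {mpoly K[n]}).

Lemma gen_ideal0 G : gen_ideal G 0.
Proof. by exists [::] => //; rewrite big_nil. Qed.

Lemma gen_ideal_gen G g : G g -> gen_ideal G g.
Proof.
move=> Gg; exists [:: (1, g)]; last by rewrite big_seq1 mul1r.
by move=> ag; rewrite inE => /eqP->.
Qed.

Lemma gen_idealD G p q : gen_ideal G p -> gen_ideal G q -> gen_ideal G (p + q).
Proof.
move=> [s sG ->] [t tG ->]; exists (s ++ t); last by rewrite big_cat.
by move=> ag; rewrite mem_cat => /orP[/sG|/tG].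
Qed.

Lemma gen_idealM G p q : gen_ideal G q -> gen_ideal G (p * q).
Proof.
move=> [s sG ->]; exists [seq (p * ag.1, ag.2) | ag <- s].
  by move=> _ /mapP[ag /sG Gag ->].
by rewrite big_map big_distrr; apply: eq_bigr => ag _; exact: mulrA.
Qed.

Lemma gen_idealN G p : gen_ideal G p -> gen_ideal G (- p).
Proof. by rewrite -mulN1r; exact: gen_idealM. Qed.

Lemma gen_idealZ G (c : K) p : gen_ideal G p -> gen_ideal G (c *: p).
Proof. by rewrite -mul_mpolyC; exact: gen_idealM. Qed.

Lemma gen_ideal_sum G (I : Type) (s : seq I) (P : pred I) (F : I -> {mpoly K[n]}) :
  (forall i, P i -> gen_ideal G (F i)) -> gen_ideal G (\sum_(i <- s | P i) F i).
Proof.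
move=> GF; apply: big_ind => //; [exact: gen_ideal0 | exact: gen_idealD].
Qed.

Lemma gen_ideal_trans G H p :
  (forall g, G g -> gen_ideal H g) -> gen_ideal G p -> gen_ideal H p.
Proof.
move=> GH [s sG ->]; rewrite big_seq; apply: gen_ideal_sum => ag ags.
by apply: gen_idealM; apply: GH; exact: sG.
Qed.

Lemma pihomogM_homog d k p g :
  g \is d.-homog ->
  pihomog mdeg k (p * g) = if (d <= k)%N then pihomog mdeg (k - d) p * g else 0.
Proof.
move=> hg; elim/mpolyind: p => [|c m p _ _ IHp].
  by rewrite mul0r !pihomog0 mul0r if_same.
rewrite mulrDl !pihomogD IHp -scalerAl !linearZ /= pihomogX.
have hm : 'X_[m] * g \is (mdeg m + d).-homog.
  by apply: dhomogM => //; rewrite dhomogX.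
have [dk|kd] := leqP d k; last first.
  by rewrite addr0 (@pihomog_ne0 _ _ _ _ _ _ _ hm) ?scaler0 // gtn_eqF // ltn_addl.
rewrite mulrDl; congr (_ + _); case: eqP => [mk|mk].
  by rewrite -scalerAl pihomog_dE // -(subnK dk) -mk.
rewrite scaler0 mul0r (@pihomog_ne0 _ _ _ _ _ _ _ hm) ?scaler0 //.
by apply: contra_not_neq mk => <-; rewrite addnK.
Qed.

(** Taking the part of degree k in an expression of p discards the generators of
    degree above k. *)
Lemma gen_ideal_low_degree G p k :
    (forall g, G g -> exists d, g \is d.-homog) ->
    p \is k.-homog -> gen_ideal G p ->
  gen_ideal (fun g => G g /\ exists2 d, (d <= k)%N & g \is d.-homog) p.
Proof.
move=> hG hp [s sG ps]; rewrite -(pihomog_dE hp) ps raddf_sum /= big_seq.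
apply: gen_ideal_sum => ag /sG Gg; have [d hd] := hG _ Gg.
rewrite (pihomogM_homog _ _ hd); case: leqP => [dk|_]; last exact: gen_ideal0.
by apply/gen_idealM/gen_ideal_gen; split=> //; exists d.
Qed.

(** The elements of I of degree less than r only involve generators of degree
    less than r, hence not g itself.  If they generated g, the generating set
    without g would still generate I. *)
Lemma min_generator_not_low I g r :
    min_generator I g -> g != 0 -> g \is r.-homog ->
  ~ gen_ideal (fun p => I p /\ exists2 k, (k < r)%N & p \is k.-homog) g.
Proof.
move=> [G [[hG genG] minG] Gg] g0 hg low.
pose H p := G p /\ p != g.
have HG p : H p -> G p by case.
have gH : gen_ideal H g.
  apply: gen_ideal_trans low => p [Ip [k kr hp]].
  apply: gen_ideal_trans (gen_ideal_low_degree hG hp (proj1 (genG p) Ip)) => q.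
  case=> Gq [e ek hq]; apply: gen_ideal_gen; split=> //.
  apply: contraTneq kr => qg; rewrite -leqNgt.
  by rewrite (dhomog_uniq g0 hg (_ : g \is e.-homog)) // -qg.
suff genH : homog_generating I H by case: (minG H genH HG g Gg) => _ /eqP.
split=> [p /HG /hG //|p]; rewrite genG; split; last first.
  by apply: gen_ideal_trans => q /HG; exact: gen_ideal_gen.
apply: gen_ideal_trans => q Gq; have [->//|qg] := eqVneq q g.
exact: gen_ideal_gen.
Qed.

End GenIdeal.

(** * The toric ideal in large degree *)

Lemma sum_eq0_over_fibres (I J : eqType) (R : nzRingType)
    (V : lmodType R) (s : seq I)
    (h : I -> J) (c : I -> R) (F : J -> V) :
    (forall j, (\sum_(i <- s | h i == j) c i = 0)%R) ->
  (\sum_(i <- s) c i *: F (h i) = 0)%R.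
Proof.
move=> c0.
have -> : (\sum_(i <- s) c i *: F (h i) =
    \sum_(i <- s) \sum_(j <- undup [seq h i | i <- s] | h i == j) c i *: F j)%R.
  rewrite big_seq [RHS]big_seq; apply: eq_bigr => i si.
  rewrite (big_rem (h i)) ?mem_undup ?map_f //= eqxx big1_seq ?addr0 // => j.
  by case/andP=> /eqP <-; rewrite mem_rem_uniqF ?undup_uniq.
rewrite (exchange_big_dep predT) //= big1 // => j _.
by rewrite -scaler_suml c0 scale0r.
Qed.

Section ToricIdeal.
Variables (K : fieldType) (d : Order.disp_t) (L : finTBDistrLatticeType d).
Local Notation n := #|max_chains L|.
Local Notation mchain i := (@enum_val _ (mem (max_chains L)) i).
Implicit Types (m q : 'X_{1..n}).

Definition mchain_mult m : 'X_{1..#|L|} :=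
  [multinom chain_mult m (enum_val j) | j < #|L|].

Lemma mchain_multP m m' :
  chain_mult m =1 chain_mult m' <-> mchain_mult m = mchain_mult m'.
Proof.
split=> [mm'|/mnmP mm' x]; first by apply/mnmP=> j; rewrite !mnmE.
by have := mm' (enum_rank x); rewrite !mnmE enum_rankK.
Qed.

Local Open Scope ring_scope.

Lemma toric_mapX m : @toric_map K d L 'X_[m] = 'X_[mchain_mult m].
Proof.
rewrite /toric_map mmapX /mmap1.
under eq_bigr => i _ do rewrite /chain_monomial mprodXE mpolyXn.
rewrite mprodXE; congr 'X_[_]; apply/mnmP=> j; rewrite mnm_sumE mnmE.
apply: eq_bigr => i _; rewrite mulmnE mnm_sumE mulnC; congr (_ * _)%N.
under eq_bigr => x _ do rewrite mnm1E (can2_eq (@enum_rankK _) (@enum_valK _)).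
exact: sum_mem_eq.
Qed.

Lemma toric_mapE (p : chain_ring K L) :
  toric_map p = \sum_(m <- msupp p) p@_m *: 'X_[mchain_mult m].
Proof.
rewrite /toric_map /mmap. apply: eq_bigr => m _.
by rewrite mul_mpolyC -toric_mapX /toric_map mmapX.
Qed.

Definition low_relation r (p : chain_ring K L) : Prop :=
  toric_ideal p /\ exists2 k, (k < r)%N & p \is k.-homog.

Lemma binomial_low_relation r m m' :
    chain_mult m =1 chain_mult m' -> mdeg m = mdeg m' -> (mdeg m < r)%N ->
  low_relation r ('X_[m] - 'X_[m']).
Proof.
move=> mm' dmm' mr; split; last first.
  by exists (mdeg m) => //; apply: rpredB; rewrite dhomogX; apply/eqP.
rewrite /toric_ideal /toric_map raddfB /= -!/(toric_map _) !toric_mapX.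
by rewrite (proj1 (mchain_multP m m') mm') subrr.
Qed.

Lemma binomial_shared_variable m m' i :
    chain_mult m =1 chain_mult m' -> mdeg m = mdeg m' -> (0 < m i)%N -> (0 < m' i)%N ->
  gen_ideal (low_relation (mdeg m)) ('X_[m] - 'X_[m']).
Proof.
move=> mm' dmm' mi m'i.
have split_i q : (0 < q i)%N -> q = (U_(i) + (q - U_(i)))%MM.
  move=> qi; rewrite addmC submK //; apply/mnm_lepP=> j; rewrite mnm1E.
  by case: eqP => [<-|].
rewrite (split_i m mi) (split_i m' m'i) !mpolyXD -mulrBr mdegD mdeg1.
apply/gen_idealM/gen_ideal_gen/binomial_low_relation => //.
- move=> x; move: (mm' x); rewrite {1}(split_i m mi) {1}(split_i m' m'i) !chain_multD.
  by move/addnI.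
- by move: dmm'; rewrite {1}(split_i m mi) {1}(split_i m' m'i) !mdegD => /addnI.
Qed.

(** The distinct chains of m are traded for a multiset q containing a chain of
    m', at the cost of a binomial of degree mdeg (mrad m) < mdeg m; the result
    shares a chain with m'. *)
Lemma binomial_not_squarefree m m' i :
    chain_mult m =1 chain_mult m' -> mdeg m = mdeg m' -> (1 < m i)%N ->
  gen_ideal (low_relation (mdeg m)) ('X_[m] - 'X_[m']).
Proof.
move=> mm' dmm' mi.
have rad_lt : (mdeg (mrad m) < mdeg m)%N.
  rewrite !mdegE (bigD1 i) //= [X in (_ < X)%N](bigD1 i) //= -addSn.
  apply: leq_add; first by rewrite mnmE (ltnW mi).
  by apply: leq_sum => j _; exact: (mnm_lepP (mrad_le m)).
have [j m'j] : exists j, (0 < m' j)%N.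
  apply/existsP; apply: contraLR rad_lt => /existsPn h; rewrite -leqNgt dmm'.
  by rewrite [mdeg m']mdegE big1 // => j _; apply/eqP; rewrite -leqn0 leqNgt.
have [q [qj dq qm]] := chain_mult_exchange mm' dmm' m'j.
pose w := (m - mrad m)%MM.
have mE : m = (mrad m + w)%MM by rewrite addmC submK // mrad_le.
have qwm : chain_mult (q + w)%MM =1 chain_mult m.
  by move=> x; rewrite chain_multD qm -chain_multD -mE.
have dqw : mdeg (q + w)%MM = mdeg m by rewrite mdegD dq -mdegD -mE.
have -> : 'X_[m] - 'X_[m'] =
    'X_[w] * ('X_[mrad m] - 'X_[q]) + ('X_[q + w] - 'X_[m']) :> chain_ring K L.
  by rewrite mulrBr -!mpolyXD ![(w + _)%MM]addmC -mE addrA subrK.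
apply: gen_idealD.
  apply/gen_idealM/gen_ideal_gen/binomial_low_relation => //.
rewrite -dqw; apply: (binomial_shared_variable (i := j)) => //.
- by move=> x; rewrite qwm.
- by rewrite dqw.
- by rewrite mnmDE ltn_addr.
Qed.

(** If m and m' neither share a chain nor repeat one, they consist of
    mdeg m + mdeg m' distinct maximal chains. *)
Lemma binomial_generated_low m m' :
    (n < 2 * mdeg m)%N -> chain_mult m =1 chain_mult m' -> mdeg m = mdeg m' ->
  gen_ideal (low_relation (mdeg m)) ('X_[m] - 'X_[m']).
Proof.
move=> n_lt mm' dmm'.
have [i /andP[mi m'i]|disj] := pickP (fun i => (0 < m i)%N && (0 < m' i)%N).
  exact: (binomial_shared_variable mm' dmm' mi m'i).
have [i mi|sm] := pickP (fun i => (1 < m i)%N).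
  exact: (binomial_not_squarefree mm' dmm' mi).
have [i m'i|sm'] := pickP (fun i => (1 < m' i)%N).
  rewrite -opprB dmm'; apply/gen_idealN/(binomial_not_squarefree _ _ m'i) => //.
have : (mdeg m + mdeg m' <= n)%N.
  suff: (\sum_(i < n) (m i + m' i) <= \sum_(i < n) 1)%N.
    by rewrite sum1_card card_ord big_split -!mdegE.
  apply: leq_sum => i _; move: (disj i) (sm i) (sm' i).
  by case: (m i) (m' i) => [|[|?]] [|[|?]].
by rewrite leqNgt -dmm' addnn -mul2n n_lt.
Qed.

(** In each fibre of the support of p the coefficients sum to zero, so
    subtracting from every monomial a fixed representative of its fibre does
    not change p. *)
Lemma toric_ideal_generated_low r (p : chain_ring K L) :
    (n < 2 * r)%N -> p \is r.-homog -> toric_ideal p ->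
  gen_ideal (low_relation r) p.
Proof.
move=> n_lt hp tp.
have degp m : m \in msupp p -> mdeg m = r by move/(dhomogP _ _ _ hp).
have coef0 e : \sum_(m <- msupp p | mchain_mult m == e) p@_m = 0.
  transitivity ((toric_map p)@_e); last by rewrite tp mcoeff0.
  rewrite toric_mapE raddf_sum big_mkcond /=.
  apply: eq_bigr => m _; rewrite mcoeffZ mcoeffX.
  by case: eqP => _; rewrite ?mulr1 ?mulr0.
pose rep e := nth 0%MM [seq m <- msupp p | mchain_mult m == e] 0.
have repP m : m \in msupp p -> rep (mchain_mult m) \in msupp p /\
    mchain_mult (rep (mchain_mult m)) = mchain_mult m.
  move=> mp; have : rep (mchain_mult m) \in
      [seq q <- msupp p | mchain_mult q == mchain_mult m].
    apply: mem_nth; rewrite size_filter -has_count; apply/hasP; exists m => //=.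
  by rewrite mem_filter => /andP[/eqP].
have -> : p = \sum_(m <- msupp p) p@_m *: ('X_[m] - 'X_[rep (mchain_mult m)]).
  under eq_bigr => m _ do rewrite scalerBr.
  rewrite sumrB -mpolyE.
  by rewrite (sum_eq0_over_fibres (fun e => 'X_[rep e]) coef0) subr0.
rewrite big_seq; apply: gen_ideal_sum => m mp; have [rp rm] := repP m mp.
apply: gen_idealZ; rewrite -(degp m mp); apply: binomial_generated_low.
- by rewrite degp.
- exact/mchain_multP.
- by rewrite !degp.
Qed.

End ToricIdeal.

(* msize is 1 + the total degree, and a minimal generator is nonzero. *)
Theorem corollary2p9 (K : fieldType) (d : Order.disp_t)
    (L : finTBDistrLatticeType d) (g : {mpoly K[#|max_chains L|]}) :
  min_generator (@toric_ideal K d L) g ->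
  2 * (msize g).-1 <= #|max_chains L|.
Proof.
move=> ming; have [->|g0] := eqVneq g 0%R; first by rewrite msize0 muln0.
have [G [[hG genG] _] Gg] := ming.
have [r hr] := hG g Gg; have hg := dhomog_msize hr.
rewrite leqNgt; apply/negP => n_lt; apply: (min_generator_not_low ming g0 hg).
apply: toric_ideal_generated_low => //.
by apply/genG; exact: gen_ideal_gen.
Qed.
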